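(* Let $\alpha\in(0,1)$ be irrational and $\beta\in(0,1)$. The restriction $\tilde j$ of $j$ to $\tilde I=I\setminus(O(0)\cup O(1-\beta))$ is a homeomorphism between $\tilde I$ and $$\tilde\Omega=\Omega\setminus\bigl(O(v_0)\cup O(\omega_0)\cup O(v_{(1-\beta)})\cup O(\omega_{(1-\beta)})\bigr).$$
   Context: $I=[0,1)$ is identified with the circle $\mathbb R/\mathbb Z$ (with its compact topology), and $S:I\to I$, $S(x)=x+\alpha \bmod 1$. For $\theta\in I$ let $v_\theta\in\{0,1\}^{\mathbb Z}$, $v_\theta(n)=\chi_{[1-\beta,1)}(\alpha n+\theta \bmod 1)$. The set $\{0,1\}^{\mathbb Z}$ carries the product topology and $T$ is the shift $(Tu)(n)=u(n+1)$. Put $$\Omega=\{\omega\in\{0,1\}^{\mathbb Z}:\omega=\lim_{i\to\infty}T^{n_i}v_0\text{ for some sequence }n_i\to\infty\}.$$ The map $j:I\to\{0,1\}^{\mathbb Z}$ is $j(\theta)=v_\theta$. Orbits: $O(\theta)=\{S^n\theta:n\in\mathbb Z\}$ for $\theta\in I$, and $O(\omega)=\{T^n\omega:n\in\mathbb Z\}$ for $\omega\in\Omega$. A sequence $(\theta_n)$ in $I$ converging to $\theta$ in $I\cong\mathbb R/\mathbb Z$ converges to $\theta$ from the left ($\theta_n\to\theta-$) if there are $\delta>0$ with $[\theta,\theta+\delta)\subset I$ and $n_0$ such that $\theta_n\notin[\theta,\theta+\delta)$ for all $n\ge n_0$. The limits $\omega_0=\lim_{\theta\to0-}j(\theta)$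 and $\omega_{(1-\beta)}=\lim_{\theta\to(1-\beta)-}j(\theta)$ exist in $\{0,1\}^{\mathbb Z}$ and belong to $\Omega$. Subsets carry the subspace topology. *)

(* Defs.v *)
From HB Require Import structures.
From mathcomp Require Import all_boot all_order all_algebra.
From mathcomp Require Import all_classical all_reals.
From mathcomp Require Import topology.

Set Implicit Arguments.
Unset Strict Implicit.
Unset Printing Implicit Defensive.

Import Order.TTheory GRing.Theory Num.Theory.
Import numFieldTopology.Exports.

Local Open Scope classical_set_scope.
Local Open Scope ring_scope.

(* [ziter f g] is the family of powers f^n, n in Z, of a bijection f with
   inverse g. *)
Definition ziter (X : Type) (f g : X -> X) (n : int) : X -> X :=
  match n with
  | Posz k => iter k f
  | Negz k => iter k.+1 g
  end.

Definition zorbit (X : Type) (f g : X -> X) (x : X) : set X :=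
  [set ziter f g n x | n in [set: int]].

(* [f], restricted to [A], is a homeomorphism of [A] onto [B], both carrying
   the subspace topology. *)
Definition homeomorphism_on (X Y : topologicalType) (A : set X) (B : set Y)
    (f : X -> Y) : Prop :=
  [/\ set_bij A B f, {within A, continuous f} &
      exists2 g : Y -> X, {in A, cancel f g} & {within B, continuous g}].

Record circle (R : realType) := Circle {
  cval :> R;
  cval_itv : cval \in `[0, 1[
}.

Section Circle.
Variable R : realType.

Lemma frac_itv (x : R) : x - (Num.floor x)%:~R \in `[0, 1[.
Proof.
by rewrite in_itv /= subr_ge0 floor_le /= ltrBlDl -[X in _ + X]/(1%:~R) -intrD
  floorD1_gt.
Qed.

Definition mod1 (x : R) : circle R := Circle (frac_itv x).

Lemma cval_inj : injective (@cval R).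
Proof.
move=> [x hx] [y hy] /= exy; rewrite exy in hx *.
by rewrite (bool_irrelevance hx hy).
Qed.

Lemma cvalK : cancel (@cval R) mod1.
Proof.
move=> x; apply: cval_inj => /=.
have := cval_itv x; rewrite in_itv /= => hx.
by rewrite (@floor_def _ (cval x) 0) ?subr0.
Qed.

End Circle.

(* [circle R] is the quotient of R by x |-> x mod 1 and carries the quotient
   topology: this is R/Z, not the topology of [0, 1[ as a subset of R. *)
HB.instance Definition _ (R : realType) :=
  isQuotient.Build R (circle R) (@cvalK R).

HB.instance Definition _ (R : realType) :=
  Topological.copy (circle R) (quotient_topology (circle R)).

Lemma circle_openE (R : realType) (U : set (circle R)) :
  open U = open (@mod1 R @^-1` U).
Proof.
rewrite [LHS]/(open (_ @^-1` U)); congr (open (_ @^-1` U)).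
by apply/funext => x; rewrite unlock.
Qed.

Section LeftLimits.
Variables (R : realType) (Y : topologicalType).

Definition cvg_left (u : nat -> circle R) (theta : circle R) : Prop :=
  u @ \oo --> theta /\
  exists delta : R,
    [/\ 0 < delta,
        [set` `[cval theta, cval theta + delta[] `<=` [set` `[(0 : R), 1[] &
        exists n0 : nat, forall n : nat, (n0 <= n)%N ->
          cval (u n) \notin `[cval theta, cval theta + delta[].

Definition is_left_lim (f : circle R -> Y) (theta : circle R) (l : Y) : Prop :=
  forall u : nat -> circle R, cvg_left u theta -> (f \o u) @ \oo --> l.

(* Meaningful only when a left limit exists; the default [f theta] is junk. *)
Definition left_lim (f : circle R -> Y) (theta : circle R) : Y :=
  xget (f theta) [set l | is_left_lim f theta l].

End LeftLimits.

(* {0,1}^Z with the product topology, [true] standing for 1. *)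
Notation binseq := {ptws int -> bool}.

Definition seq_shift (u : binseq) : binseq := fun n : int => u (n + 1).
Definition seq_shift_inv (u : binseq) : binseq := fun n : int => u (n - 1).

Lemma seq_shiftK : cancel seq_shift seq_shift_inv.
Proof. by move=> u; apply/funext => n; rewrite /seq_shift /seq_shift_inv subrK. Qed.

Lemma seq_shift_invK : cancel seq_shift_inv seq_shift.
Proof. by move=> u; apply/funext => n; rewrite /seq_shift /seq_shift_inv addrK. Qed.

Section Sturmian.
Variables (R : realType) (alpha beta : R).

Definition rotation (x : circle R) : circle R := mod1 (cval x + alpha).
Definition rotation_inv (x : circle R) : circle R := mod1 (cval x - alpha).

Lemma mod1D (x y : R) : mod1 (cval (mod1 x) + y) = mod1 (x + y).
Proof.
apply: cval_inj => /=; set m := Num.floor x.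
have -> : x - m%:~R + y = x + y + (- m)%:~R by rewrite mulrNz addrAC.
by rewrite floorDrz ?intr_int // intrKfloor intrD mulrNz opprD opprK addrACA
  addNr addr0.
Qed.

Lemma rotationK : cancel rotation rotation_inv.
Proof.
by move=> x; rewrite /rotation /rotation_inv mod1D addrK cvalK.
Qed.

Lemma rotation_invK : cancel rotation_inv rotation.
Proof.
by move=> x; rewrite /rotation /rotation_inv mod1D subrK cvalK.
Qed.

(* [coding theta] is v_theta; as a function of theta it is j. *)
Definition coding (theta : circle R) : binseq :=
  fun n : int => cval (mod1 (alpha * n%:~R + cval theta)) \in `[1 - beta, 1[.

Definition Omega : set binseq :=
  [set omega | exists n : nat -> nat, n @ \oo --> \oo /\
     (fun i => iter (n i) seq_shift (coding (mod1 0))) @ \oo --> omega].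

Definition orbitS : circle R -> set (circle R) := zorbit rotation rotation_inv.
Definition orbitT : binseq -> set binseq := zorbit seq_shift seq_shift_inv.

Definition Itilde : set (circle R) :=
  ~` (orbitS (mod1 0) `|` orbitS (mod1 (1 - beta))).

Definition Omegatilde : set binseq :=
  Omega `\` (orbitT (coding (mod1 0)) `|`
             orbitT (left_lim coding (mod1 0)) `|`
             orbitT (coding (mod1 (1 - beta))) `|`
             orbitT (left_lim coding (mod1 (1 - beta)))).

End Sturmian.

(* Main.v *)
(* Two symbols of v_x already locate x: if n alpha moves x to just after an
   integer and m alpha moves x to just before one, then v_x(n) = 0, v_x(m) = 1,
   and any y whose coding has these two symbols lies within the two gaps of x
   mod 1.  The same holds when the indicator of [1-beta, 1) is replaced by its
   left limit, the indicator of (1-beta, 1].  Density of the orbits provides n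
   and m with arbitrarily small gaps; this gives injectivity, continuity of the
   inverse, and the fact that v_x is in none of the excluded orbits when x is in
   I-tilde.  Conversely, for a limit omega of translates of v_0, let x be a
   cluster point of the corresponding points n_i alpha of [0, 1]; they
   approach x infinitely often from the right or eventually from the left only,
   so omega is v_x or the left limit of v at x, and these coincide exactly when
   no translate of x is a discontinuity. *)
Require Import Defs.
From HB Require Import structures.
From mathcomp Require Import all_boot all_order all_algebra.
From mathcomp Require Import all_classical all_reals.
From mathcomp Require Import topology normedtype interval_inference.
From mathcomp Require Import lra.

Set Implicit Arguments.
Unset Strict Implicit.
Unset Printing Implicit Defensive.

Import Order.TTheory GRing.Theory Num.Theory.
Import numFieldTopology.Exports numFieldNormedType.Exports.

Local Open Scope classical_set_scope.
Local Open Scope ring_scope.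

(** * Density mod 1 of the forward multiples of an irrational number *)

Section Density.
Variable R : realType.
Implicit Types (alpha a b e : R).

(** Pigeonhole: among N+2 multiples of [alpha], two have fractional parts in the same one of N+1
    boxes of width below [e]. Their difference is the multiple sought, and irrationality keeps it
    from vanishing. *)
Lemma small_multiple alpha e : irrational alpha -> 0 < e ->
  exists (m : nat) (k : int),
    (0 < m)%N /\ 0 < `|m%:R * alpha + k%:~R| < e.
Proof.
move=> irr e0; pose N := Num.truncn e^-1.
have Ne : e^-1 < N.+1%:R by rewrite -truncn_le_nat.
pose fr (i : nat) := i%:R * alpha - (Num.floor (i%:R * alpha))%:~R.
have fr0 i : 0 <= fr i by rewrite subr_ge0 floor_le.
have fr1 i : fr i < 1.
  by have := floorD1_gt (i%:R * alpha); rewrite intrD /fr; lra.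
pose box i := Num.truncn (N.+1%:R * fr i).
have boxN i : (box i < N.+1)%N.
  by rewrite truncn_lt_nat ?mulr_ge0// gtr_pMr// ltr0n.
have [i [j [ij Eij]]] : exists i j : nat, (i < j)%N /\ box i = box j.
  have /injectivePn[i [j ij Eij]] :
      ~~ injectiveb (fun i : 'I_N.+2 => Ordinal (boxN i)).
    by apply/injectiveP => /leq_card; rewrite !card_ord ltnn.
  have {}Eij : box i = box j by move: Eij => [].
  by case: (ltngtP i j) ij => [lij|lij|/val_inj->]; rewrite ?eqxx// => _;
    [exists i, j | exists j, i].
exists (j - i)%N, (Num.floor (i%:R * alpha) - Num.floor (j%:R * alpha)).
rewrite subn_gt0; split=> //; apply/andP; split.
  rewrite normr_gt0; apply/eqP => /(canRL (addrK _)); rewrite add0r => E.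
  apply: irr; apply/rationalP.
  exists (Num.floor (j%:R * alpha) - Num.floor (i%:R * alpha)), (j - i)%N.
  rewrite -opprB mulrNz -E mulrAC mulfV ?mul1r// pnatr_eq0.
  by rewrite -lt0n subn_gt0.
have -> : (j - i)%:R * alpha + (Num.floor (i%:R * alpha)
    - Num.floor (j%:R * alpha))%:~R = fr j - fr i.
  by rewrite natrB 1?ltnW// intrB /fr; lra.
have [/andP[i1 i2] /andP[j1 j2]] :
    ((box i)%:R <= N.+1%:R * fr i < (box i).+1%:R) /\
    ((box j)%:R <= N.+1%:R * fr j < (box j).+1%:R).
  by split; apply: truncn_itv; rewrite mulr_ge0.
rewrite -[e]invrK (@lt_trans _ _ N.+1%:R^-1)// ?ltf_pV2 ?posrE ?invr_gt0//.
rewrite -[X in _ < X]mulr1 ltr_pdivlMl//.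
rewrite -[X in X * _](gtr0_norm (ltr0Sn R N)) -normrM mulrBr ltr_norml.
by move: i1 i2 j1 j2; rewrite Eij -!(natr1 (box j)); lra.
Qed.

(** Steps of length [d], shorter than the interval, cannot jump over any integer translate of it. *)
Lemma dense_multiples_step alpha a b (m N : nat) (k : int) :
  (0 < m)%N -> 0 < m%:R * alpha + k%:~R < b - a ->
  exists (n : nat) (l : int),
    (N <= n)%N /\ a < n%:R * alpha + l%:~R < b.
Proof.
set d := _ + _ => m0 /andP[d0 dba].
(* The shift by [l] moves the interval past [N * d], so the first multiple of [d] beyond its left
   end has index [t >= N]. *)
pose l := Num.floor (N%:R * d - a) + 1.
have hl : N%:R * d < a + l%:~R by rewrite addrC -ltrBlDr floorD1_gt.
pose t := (Num.truncn ((a + l%:~R) / d)).+1.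
have al0 : 0 <= (a + l%:~R) / d.
  by rewrite divr_ge0 ?ltW// (le_lt_trans _ hl)// mulr_ge0// ltW.
have /andP[t1 t2] := truncn_itv al0.
exists (t * m)%N, (t%:Z * k - l); split.
  rewrite (@leq_trans t) ?leq_pmulr//.
  by rewrite -(ler_nat R) ltW// (lt_trans _ t2)// ltr_pdivlMr.
move: t1 t2; rewrite ler_pdivlMr// ltr_pdivrMr// -/t => t1 t2.
have -> : (t * m)%:R * alpha + (t%:Z * k - l)%:~R = t%:R * d - l%:~R.
  by rewrite natrM intrB intrM /d -pmulrn; lra.
have {}t1 : t%:R * d - d <= a + l%:~R by rewrite /t -natr1 mulrDl mul1r addrK.
by apply/andP; split; lra.
Qed.

(** If the small multiple is negative, reflection to [- alpha] reduces to the positive case. The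
    bound [N] later lets the times tend to infinity. *)
Lemma dense_multiples alpha a b (N : nat) : irrational alpha -> a < b ->
  exists (n : nat) (l : int),
    (N <= n)%N /\ a < n%:R * alpha + l%:~R < b.
Proof.
move=> irr ab; have ba0 : 0 < b - a by rewrite subr_gt0.
have [m [k [m0]]] := small_multiple irr ba0.
have [d0|d0] := ltrP 0 (m%:R * alpha + k%:~R).
  by rewrite gtr0_norm// => hd; exact: dense_multiples_step m0 hd.
rewrite ler0_norm// => hd.
have [||n [l [Nn hn]]] :=
    @dense_multiples_step (- alpha) (- b) (- a) m N (- k) => //.
  by rewrite mulrN mulrNz; lra.
by exists n, (- l); split=> //; rewrite mulrNz; move: hn; rewrite mulrN; lra.
Qed.

End Density.

(** * Congruence mod 1 of real numbers *)

Lemma ltr_intD1 (R : realType) (a b : int) : (a%:~R < b%:~R + 1 :> R) = (a <= b).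
Proof. by rewrite -[X in _ + X]/(1%:~R) -intrD ltr_int ltzD1. Qed.

Lemma mod1Dz (R : realType) (x : R) (k : int) : mod1 (x + k%:~R) = mod1 x.
Proof.
apply: cval_inj => /=; rewrite floorDrz ?intr_int// intrKfloor intrD.
by rewrite opprD addrACA subrr addr0.
Qed.

(** Otherwise the distance from [y - x] to the nearest integer is a positive [e] that no [k]
    beats. *)
Lemma mod1_eq_approx (R : realType) (x y : R) :
  (forall e, 0 < e -> exists k : int, `|y - x - k%:~R| < e) -> mod1 y = mod1 x.
Proof.
move=> approx; pose l := Num.floor (y - x).
have /andP[l0 l1] : l%:~R <= y - x < l%:~R + 1.
  by have := floor_itv (y - x); rewrite intrD.
have [E|lneq] := eqVneq l%:~R (y - x).
  by rewrite (_ : y = x + l%:~R) ?mod1Dz// E; lra.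
have {lneq l0} l0 : l%:~R < y - x by rewrite lt_neqAle lneq.
have e0 : 0 < Num.min (y - x - l%:~R) (l%:~R + 1 - (y - x)).
  by rewrite lt_min; apply/andP; split; lra.
have [k] := approx _ e0; rewrite lt_min !ltr_norml => /andP[/andP[_ k1] /andP[k2 _]].
have : k%:~R < l%:~R + 1 :> R by lra.
rewrite ltr_intD1 => kl; suff : (l < k) by rewrite ltNge kl.
by rewrite -(ltr_int R); lra.
Qed.

(** * The indicator, its left limit, and locating a point from two symbols *)

Section Window.
Variables (R : realType) (alpha beta : R).
Hypothesis hbeta : 0 < beta < 1.
Implicit Types (x y z e : R) (n k : int).

Definition window y : bool := cval (mod1 y) \in `[1 - beta, 1[.

(* The left limit of [window] at [y]: the indicator of (1-beta, 1] mod 1. *)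
Definition window_left y : bool := cval (mod1 (- y)) < beta.

(** This and the next three criteria trade the floor for an unknown integer, which leaves only
    linear arithmetic later. *)
Lemma windowP y : reflect (exists k, k%:~R - beta <= y < k%:~R) (window y).
Proof.
have /andP[beta0 beta1] := hbeta.
have := floor_itv y; rewrite intrD => /andP[f0 f1].
apply: (iffP idP) => [|[k /andP[k0 k1]]]; rewrite /window in_itv /=.
  move=> /andP[w0 _]; exists (Num.floor y + 1); rewrite intrD.
  by apply/andP; split; lra.
rewrite (@floor_def _ y (k - 1)); first by rewrite intrB; lra.
by rewrite subrK intrB; lra.
Qed.

Lemma windowPn y :
  reflect (exists k, k%:~R <= y < k%:~R + 1 - beta) (~~ window y).
Proof.
have /andP[beta0 beta1] := hbeta.
have := floor_itv y; rewrite intrD => /andP[f0 f1].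
apply: (iffP idP) => [|[k /andP[k0 k1]]]; rewrite /window in_itv /=.
  rewrite negb_and -!ltNge => w; exists (Num.floor y).
  by apply/andP; split; first lra; move: w; rewrite -leNgt; lra.
rewrite (@floor_def _ y k); first by rewrite negb_and; lra.
by rewrite intrD; lra.
Qed.

Lemma window_leftP y :
  reflect (exists k, k%:~R - beta < y <= k%:~R) (window_left y).
Proof.
have /andP[beta0 beta1] := hbeta.
have := floor_itv (- y); rewrite intrD => /andP[f0 f1].
apply: (iffP idP) => [|[k /andP[k0 k1]]]; rewrite /window_left /=.
  by move=> w; exists (- Num.floor (- y)); rewrite mulrNz; apply/andP; split; lra.
rewrite (@floor_def _ (- y) (- k)); first by rewrite mulrNz; lra.
by rewrite intrD mulrNz; lra.
Qed.

Lemma window_leftPn y :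
  reflect (exists k, k%:~R < y <= k%:~R + 1 - beta) (~~ window_left y).
Proof.
have /andP[beta0 beta1] := hbeta.
have := floor_itv (- y); rewrite intrD => /andP[f0 f1].
apply: (iffP idP) => [|[k /andP[k0 k1]]]; rewrite /window_left /= -leNgt.
  move=> w; exists (- Num.floor (- y) - 1); rewrite intrB mulrNz.
  by apply/andP; split; lra.
rewrite (@floor_def _ (- y) (- k - 1)); first by rewrite intrB mulrNz; lra.
by rewrite intrD intrB mulrNz; lra.
Qed.

Lemma window_near_left y :
  exists2 e, 0 < e & forall z, y - e < z < y -> window z = window_left y.
Proof.
have /andP[beta0 beta1] := hbeta.
have [/window_leftP[k /andP[k0 k1]]|/window_leftPn[k /andP[k0 k1]]] :=
  boolP (window_left y).
  exists (y - (k%:~R - beta)); first lra.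
  by move=> z /andP[z0 z1]; apply/windowP; exists k; lra.
exists (y - k%:~R); first lra.
by move=> z /andP[z0 z1]; apply/negbTE/windowPn; exists k; lra.
Qed.

Lemma window_near_right y :
  exists2 e, 0 < e & forall z, y <= z < y + e -> window z = window y.
Proof.
have /andP[beta0 beta1] := hbeta.
have [/windowP[k /andP[k0 k1]]|/windowPn[k /andP[k0 k1]]] := boolP (window y).
  exists (k%:~R - y); first lra.
  by move=> z /andP[z0 z1]; apply/windowP; exists k; lra.
exists (k%:~R + 1 - beta - y); first lra.
by move=> z /andP[z0 z1]; apply/negbTE/windowPn; exists k; lra.
Qed.

Lemma window_leftE y :
  (exists k, y = k%:~R \/ y = k%:~R - beta) \/ window_left y = window y.
Proof.
have /andP[beta0 beta1] := hbeta.
have [/windowP[k /andP[k0 k1]]|/windowPn[k /andP[k0 k1]]] := boolP (window y).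
  have [->|yk] := eqVneq y (k%:~R - beta); first by left; exists k; right.
  right; apply/window_leftP; exists k; rewrite [X in _ && X]ltW// andbT.
  by rewrite lt_neqAle eq_sym yk.
have [->|yk] := eqVneq y k%:~R; first by left; exists k; left.
right; apply/negbTE/window_leftPn; exists k; rewrite [X in _ && X]ltW// andbT.
by rewrite lt_neqAle eq_sym yk.
Qed.

Definition left_coding x : binseq := fun n => window_left (alpha * n%:~R + x).

Lemma coding_mod1 x n :
  coding alpha beta (mod1 x) n = window (alpha * n%:~R + x).
Proof. by rewrite /coding /window addrC mod1D addrC. Qed.

(** The two one-sided limits of the coding at [x]. A point of [Omega] is first known only up to this
    alternative, which collapses on [Itilde]. *)
Definition coding_or_left x (w : binseq) : Prop :=
  w = coding alpha beta (mod1 x) \/ w = left_coding x.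

(* Two coordinates suffice: at [n] the point [x] is moved to just after an
   integer, at [m] to just before one, so a [y] with the same symbols there is
   squeezed from both sides. *)
Lemma two_symbols_locate x e : irrational alpha -> 0 < e ->
  exists n m : int,
    [/\ coding alpha beta (mod1 x) n = false,
        coding alpha beta (mod1 x) m = true &
        forall y w, coding_or_left y w -> w n = false -> w m = true ->
          exists k, `|y - x - k%:~R| < e].
Proof.
move=> irr e0; have /andP[beta0 beta1] := hbeta.
(* The bounds [1 - beta] and [beta] give [x] the symbols 0 at [n] and 1 at [m]; the bound 1/2 serves
   to identify the two integers found below. *)
pose d := Num.min (Num.min e 2^-1) (Num.min beta (1 - beta)).
have /and4P[de d2 db d1b] :
    [&& d <= e, d <= 2^-1, d <= beta & d <= 1 - beta].
  by rewrite /d !ge_min !lexx !orbT.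
have d0 : 0 < d by rewrite /d !lt_min; lra.
have [||n [p [_ /andP[p0 p1]]]] :=
  @dense_multiples _ alpha (- x) (d - x) 0 => //; first lra.
have [||m [q [_ /andP[q0 q1]]]] :=
  @dense_multiples _ alpha (- d - x) (- x) 0 => //; first lra.
exists (n : int), (m : int); split.
- rewrite coding_mod1; apply/negbTE/windowPn; exists (- p).
  by rewrite mulrNz -pmulrn; lra.
- rewrite coding_mod1; apply/windowP; exists (- q).
  by rewrite mulrNz -pmulrn; lra.
move=> y w wy wn wm.
have [a /andP[a0 a1]] : exists a : int,
    a%:~R <= alpha * n%:R + y <= a%:~R + 1 - beta.
  case: wy wn => ->; rewrite ?coding_mod1 => /negbT.
    by case/windowPn => a; exists a; lra.
  by case/window_leftPn => a; exists a; rewrite [n%:R]pmulrn; lra.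
have [b /andP[b0 b1]] : exists b : int,
    b%:~R - beta <= alpha * m%:R + y <= b%:~R.
  case: wy wm => ->; rewrite ?coding_mod1.
    by case/windowP => b; exists b; lra.
  by case/window_leftP => b; exists b; rewrite [m%:R]pmulrn; lra.
(* The bounds [a0] and [b1] give [a + p < b + q + 2 * d], at most [b + q + 1]; the bounds [a1] and
   [b0], where [beta] cancels, give [b + q < a + p + 1]. *)
have ab : a + p = b + q.
  apply/eqP; rewrite eq_le -!(ltr_intD1 R) !intrD; apply/andP; split; lra.
exists (a + p); rewrite ltr_norml; apply/andP; split.
  by rewrite intrD; lra.
by rewrite ab intrD; lra.
Qed.

Lemma coding_or_left_inj x y : irrational alpha ->
  coding_or_left y (coding alpha beta (mod1 x)) -> mod1 y = mod1 x.
Proof.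
move=> irr xy; apply: mod1_eq_approx => e e0.
have [n [m [xn xm loc]]] := two_symbols_locate x irr e0.
exact: loc xy xn xm.
Qed.

(** * Powers of the rotation and of the shift *)

Lemma ziter_rotation x n :
  ziter (rotation alpha) (rotation_inv alpha) n (mod1 x) =
  mod1 (x + n%:~R * alpha).
Proof.
have pos (m : nat) : iter m (rotation alpha) (mod1 x) = mod1 (x + m%:R * alpha).
  elim: m => [|m IH]; first by rewrite mul0r addr0.
  by rewrite iterS IH /rotation mod1D -natr1 mulrDl mul1r addrA.
have neg (m : nat) :
    iter m (rotation_inv alpha) (mod1 x) = mod1 (x - m%:R * alpha).
  elim: m => [|m IH]; first by rewrite mul0r subr0.
  by rewrite iterS IH /rotation_inv mod1D -natr1 mulrDl mul1r opprD addrA.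
by case: n => m /=; rewrite -?iterS ?pos ?neg// NegzE mulrNz mulNr pmulrn.
Qed.

Lemma ziter_shift (w : binseq) n :
  ziter seq_shift seq_shift_inv n w = fun k : int => w (k + n).
Proof.
have pos (m : nat) : iter m seq_shift w = fun k : int => w (k + m%:Z).
  elim: m => [|m IH]; first by apply/funext => k; rewrite addr0.
  by apply/funext => k; rewrite iterS IH /seq_shift -addrA intS.
have neg (m : nat) : iter m seq_shift_inv w = fun k : int => w (k - m%:Z).
  elim: m => [|m IH]; first by apply/funext => k; rewrite subr0.
  by apply/funext => k; rewrite iterS IH /seq_shift_inv intS opprD addrA.
by case: n => m /=; rewrite -?iterS ?pos ?neg// NegzE.
Qed.

Lemma ziter_coding x n :
  ziter seq_shift seq_shift_inv n (coding alpha beta (mod1 x)) =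
  coding alpha beta (mod1 (x + n%:~R * alpha)).
Proof.
rewrite ziter_shift; apply/funext => k.
by rewrite !coding_mod1 intrD; congr window; lra.
Qed.

Lemma ziter_left_coding x n :
  ziter seq_shift seq_shift_inv n (left_coding x) =
  left_coding (x + n%:~R * alpha).
Proof.
rewrite ziter_shift; apply/funext => k.
by rewrite /left_coding intrD; congr window_left; lra.
Qed.

Lemma left_codingDz x k : left_coding (x + k%:~R) = left_coding x.
Proof.
apply/funext => n; rewrite /left_coding /window_left addrA opprD.
by rewrite -mulrNz mod1Dz.
Qed.

(** The two can differ only at a discontinuity, and rotating back [n] steps from there would put [x]
    on a removed orbit. *)
Lemma Itilde_window x n : Itilde alpha beta (mod1 x) ->
  window_left (alpha * n%:~R + x) = window (alpha * n%:~R + x).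
Proof.
move=> Ix; case: (window_leftE (alpha * n%:~R + x)) => // -[k E].
exfalso; apply: Ix; case: E => E; [left|right]; exists (- n) => //.
  rewrite ziter_rotation (_ : x = 0 + (- n)%:~R * alpha + k%:~R) ?mod1Dz//.
  by rewrite mulrNz; lra.
rewrite ziter_rotation.
(* The discontinuity is written [k - beta] but the orbit starts at [1 - beta], hence [k - 1]. *)
rewrite (_ : x = 1 - beta + (- n)%:~R * alpha + (k - 1)%:~R) ?mod1Dz//.
by rewrite mulrNz intrB; lra.
Qed.

Lemma Itilde_left_coding x : Itilde alpha beta (mod1 x) ->
  left_coding x = coding alpha beta (mod1 x).
Proof.
by move=> Ix; apply/funext => n; rewrite coding_mod1 -Itilde_window.
Qed.

End Window.

(** * Neighbourhoods in the circle and in the sequence space *)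

Lemma nbhs_mod1 (R : realType) (x : R) (U : set (circle R)) :
  nbhs (mod1 x) U <-> \forall y \near x, U (mod1 y).
Proof.
split=> [|/nbhs_ballP[e /= e0 xU]].
  rewrite nbhsE => -[B [oB Bx] BU]; apply: (filterS (P := mod1 (R := R) @^-1` B)).
    by move=> y; exact: BU.
  by apply: open_nbhs_nbhs; split => //; rewrite -circle_openE.
rewrite nbhsE; exists (mod1 (R := R) @` ball x e); last first.
  by move=> _ [y xy <-]; exact: xU.
split; last by exists x => //; exact: ballxx.
rewrite circle_openE.
(* The saturation of a ball is the union of its integer translates, so the projection is open. *)
have -> : mod1 (R := R) @^-1` (mod1 (R := R) @` ball x e) =
    \bigcup_(k : int) ball (x + k%:~R) e.
  apply/seteqP; split=> [y /= [z xz zy]|y [k _ xy]].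
    exists (Num.floor y - Num.floor z) => //.
    move: zy => /(congr1 (@cval R)) /= zy; rewrite /ball /= intrB in xz *.
    by rewrite (_ : _ - y = x - z)//; lra.
  exists (y - k%:~R); last by rewrite -mulrNz mod1Dz.
  by move: xy; rewrite /ball /= opprB addrA.
by apply: bigcup_open => k _; exact: ball_open.
Qed.

Lemma mod1_continuous (R : realType) : continuous (@mod1 R).
Proof. by move=> x U /nbhs_mod1. Qed.

(** Each factor is discrete, so coordinatewise convergence is eventual equality. *)
Lemma cvg_binseqP (F : set_system binseq) (w : binseq) : Filter F ->
  F --> w <-> forall n, \forall v \near F, v n = w n.
Proof.
move=> FF; split=> [Fw n|Fw].
  have : nbhs w [set v : binseq | v n = w n].
    have /(_ [set w n]) := @proj_continuous int (fun=> bool) n w.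
    by apply; exact: discrete_set1.
  exact: Fw.
apply/cvg_sup => n U; rewrite nbhsE => -[B [[C oC <-] Cw] BU].
by apply: filterS (Fw n) => v vw; apply: BU; rewrite /= /proj vw.
Qed.

(** * Continuity and left limits of the coding *)

Section Homeomorphism.
Variables (R : realType) (alpha beta : R).
Hypotheses (hbeta : 0 < beta < 1) (alpha_irr : irrational alpha).
Implicit Types (x y : R) (n : int) (w : binseq).
Notation coding := (coding alpha beta).
Notation left_coding := (left_coding alpha beta).
Notation Itilde := (Itilde alpha beta).
Notation Omegatilde := (Omegatilde alpha beta).

(** Near [x] each symbol is the window value on the right and its left limit on the left; these
    agree on [Itilde]. *)
Lemma coding_continuous x : Itilde (mod1 x) ->
  coding @ nbhs (mod1 x) --> coding (mod1 x).
Proof.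
move=> Ix; apply/cvg_binseqP => n; apply/nbhs_mod1.
have [e e0 left_e] := window_near_left hbeta (alpha * n%:~R + x).
have [d d0 right_d] := window_near_right hbeta (alpha * n%:~R + x).
apply/nbhs_ballP; exists (Num.min e d) => /=; first by rewrite lt_min e0.
move=> y; rewrite /ball /= lt_min !ltr_norml => /andP[/andP[e1 e2] /andP[d1 d2]].
rewrite !coding_mod1; have [yx|xy] := ltP y x.
  by rewrite left_e ?Itilde_window//; apply/andP; split; lra.
by rewrite right_d//; apply/andP; split; lra.
Qed.

Lemma is_left_lim_coding (c : circle R) :
  is_left_lim coding c (left_coding (cval c)).
Proof.
move=> u [uc [d [d0 dc [N uN]]]]; apply/cvg_binseqP => n.
have [e e0 left_e] := window_near_left hbeta (alpha * n%:~R + cval c).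
(* The lift [z] is chosen close to [cval c]; it may leave [0, 1), notably when [c] is 0. *)
have : \forall v \near nbhs c, exists2 z, v = mod1 z & `|cval c - z| < Num.min e d.
  rewrite -{1}(cvalK c); apply/nbhs_mod1/nbhs_ballP.
  exists (Num.min e d) => /=; first by rewrite lt_min e0.
  by move=> z zc; exists z.
move=> /uc uz.
change (\forall i \near \oo, coding (u i) n = left_coding (cval c) n).
near=> i.
have [z uiz] : exists2 z, u i = mod1 z & `|cval c - z| < Num.min e d.
  by near: i.
rewrite lt_min !ltr_norml => /andP[/andP[e1 e2] /andP[d1 d2]].
have [cz|zc] := leP (cval c) z; last first.
  by rewrite /= uiz coding_mod1 left_e//; apply/andP; split; lra.
(* A lift on the right lies in [0, 1) by [dc], so it is the representative of [u i], against
   [uN]. *)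
have zI : z \in `[cval c, cval c + d[.
  by rewrite in_itv /=; apply/andP; split; lra.
have : u i = Circle (dc _ zI).
  by rewrite uiz -[RHS]cvalK.
have Ni : (N <= i)%N by near: i; exists N.
by move=> ui; have := uN i Ni; rewrite ui /= zI.
Unshelve. all: by end_near. Qed.

(** Without such a sequence every [l] would be a left limit vacuously; this yields uniqueness. *)
Lemma cvg_left_exists (c : circle R) : exists u : nat -> circle R, cvg_left u c.
Proof.
have := cval_itv c; rewrite in_itv /= => /andP[c0 c1].
(* Starting at 1/2 keeps [h i] plus the [delta] chosen below at most 1, so a point wrapping around
   past 0 lands beyond [cval c + delta]. *)
pose h (i : nat) : R := i.+2%:R^-1.
have h0 i : 0 < h i by rewrite invr_gt0.
have h2 i : h i <= 2^-1 by rewrite lef_pV2 ?posrE// ler_nat.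
exists (fun i => mod1 (cval c - h i)); split.
  move=> U; rewrite -{1}(cvalK c) => /nbhs_mod1/nbhs_ballP[e /= e0 eU].
  have := near_infty_natSinv_lt (PosNum e0); apply: filterS => i /= ie.
  apply: eU; rewrite /ball /= opprB addrC subrK gtr0_norm//.
  by apply: le_lt_trans ie; rewrite lef_pV2 ?posrE// ler_nat.
exists ((1 - cval c) / 2); split; first by rewrite divr_gt0// subr_gt0.
  by move=> z /=; rewrite !in_itv /= => /andP[z0 z1]; apply/andP; split; lra.
exists 0%N => i _; apply/negP; rewrite in_itv /= => /andP[i0 i1].
have := h0 i; have := h2 i; move: i0 i1.
set f := Num.floor _ => i0 i1 hi2 hi0.
have : f < 0 by rewrite -(ltr_int R); lra.
rewrite ltNge -(ltr_intD1 R) => /negP; apply; lra.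
Unshelve. all: by end_near. Qed.

Lemma left_lim_coding (c : circle R) : left_lim coding c = left_coding (cval c).
Proof.
apply: xget_unique; first exact: is_left_lim_coding.
move=> l lim_l; have [u uc] := cvg_left_exists c.
have /cvg_binseqP ul := lim_l _ uc.
have /cvg_binseqP ulc := is_left_lim_coding uc.
apply/funext => n.
by have [v [<- <-]] := filter_ex (filterI (ul n) (ulc n)).
Qed.

Lemma left_coding_mod1 x : left_coding (cval (mod1 x)) = left_coding x.
Proof. by rewrite /= -mulrNz left_codingDz. Qed.

Lemma coding_or_left_mod1 x y w : mod1 x = mod1 y ->
  coding_or_left alpha beta x w -> coding_or_left alpha beta y w.
Proof.
by move=> xy [->|->]; [left; rewrite xy|right; rewrite -left_coding_mod1 xy
  left_coding_mod1].
Qed.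

(** * Removed orbits, limit points and the inverse map *)

Lemma orbitS_mod1 x y :
  orbitS alpha (mod1 x) (mod1 y) <-> exists n, mod1 (x + n%:~R * alpha) = mod1 y.
Proof.
split=> [[n _]|[n xy]]; first by rewrite ziter_rotation; exists n.
by exists n => //; rewrite ziter_rotation.
Qed.

Lemma orbitT_coding x w :
  (orbitT (coding (mod1 x)) `|` orbitT (left_lim coding (mod1 x))) w <->
  exists n, coding_or_left alpha beta (x + n%:~R * alpha) w.
Proof.
rewrite left_lim_coding left_coding_mod1; split.
  case=> -[n _ <-]; exists n; rewrite ?ziter_coding ?ziter_left_coding.
    by left.
  by right.
case=> n [->|->]; [left|right]; exists n => //.
  by rewrite ziter_coding.
by rewrite ziter_left_coding.
Qed.

Lemma Omegatilde_coding_or_left x w :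
  Omegatilde w -> coding_or_left alpha beta x w -> Itilde (mod1 x).
Proof.
move=> [_ Ow] xw; apply: contra_not Ow => Ox; rewrite -setUA.
by case: Ox => /orbitS_mod1[n nx]; [left|right]; apply/orbitT_coding;
  exists n; apply: coding_or_left_mod1 xw.
Qed.

Lemma Omega_coding_or_left w :
  Omega alpha beta w -> exists x, coding_or_left alpha beta x w.
Proof.
move=> [n [_ /cvg_binseqP w_lim]].
(* Real representatives allow compactness of [0, 1]. The cluster point may be 1, so [x] is kept
   real. *)
pose t i := cval (mod1 (0 + (n i)%:~R * alpha)).
have {}w_lim k : \forall i \near \oo, coding (mod1 (t i)) k = w k.
  have {}w_lim : \forall i \near \oo,
    iter (n i) seq_shift (coding (mod1 0)) k = w k := w_lim k.
  apply: filterS w_lim => i.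
  by rewrite [iter _ _ _](ziter_coding alpha beta 0 (n i)) cvalK.
have t01 : (t @ \oo) [set` `[0, 1]].
  change (\forall i \near \oo, t i \in `[0, 1]).
  apply: nearW => i /=; have := cval_itv (mod1 (0 + (n i)%:~R * alpha)).
  by rewrite !in_itv /= => /andP[-> /ltW->].
have [x [_ x_clust]] := @segment_compact R 0 1 _ _ t01.
have {}x_clust (E : set nat) e : (\forall i \near \oo, E i) -> 0 < e ->
    exists2 i, E i & `|x - t i| < e.
  move=> E_oo e0; have [||_ [[i Ei <-] xi]] := x_clust (t @` E) (ball x e).
  - by change (\forall i \near \oo, (t @` E) (t i)); apply: filterS E_oo => i; exists i.
  - exact: nbhsx_ballx.
  by exists i.
exists x.
have [from_right|] := pselect (forall (E : set nat) e,
    (\forall i \near \oo, E i) -> 0 < e -> exists2 i, E i & x <= t i < x + e).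
  left; apply/funext => k; rewrite coding_mod1.
  have [e e0 right_e] := window_near_right hbeta (alpha * k%:~R + x).
  have [i <- /andP[xi ix]] := from_right _ _ (w_lim k) e0.
  by rewrite coding_mod1 right_e//; apply/andP; split; lra.
(* The failure supplies a single pair [E], [e] valid for all coordinates [k] at once. *)
move=> /existsNP[E /existsNP[e /not_implyP[E_oo /not_implyP[e0 not_right]]]].
right; apply/funext => k.
have [d d0 left_d] := window_near_left hbeta (alpha * k%:~R + x).
have ed0 : 0 < Num.min e d by rewrite lt_min e0.
have [i [Ei <-]] := x_clust _ _ (filterI E_oo (w_lim k)) ed0.
rewrite lt_min !ltr_norml => /andP[/andP[e1 e2] /andP[d1 d2]].
have [xi|ix] := leP x (t i).
  by exfalso; apply: not_right; exists i => //; apply/andP; split; lra.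
by rewrite coding_mod1 left_d//; apply/andP; split; lra.
Qed.

Lemma Omegatilde_surj w :
  Omegatilde w -> exists2 x, Itilde (mod1 x) & coding (mod1 x) = w.
Proof.
move=> Ow; have [x xw] := Omega_coding_or_left (proj1 Ow).
have Ix := Omegatilde_coding_or_left Ow xw; exists x => //.
by case: xw => ->//; rewrite Itilde_left_coding.
Qed.

(** Density gives times [n i >= i] with [n i * alpha] within 1/(i+1) of [x] mod 1; continuity at [x]
    does the rest. *)
Lemma Omega_coding x : Itilde (mod1 x) -> Omega alpha beta (coding (mod1 x)).
Proof.
move=> Ix.
have /choice[n /all_and2[n_ge n_near]] : forall i : nat, exists n : nat,
    (i <= n)%N /\
    exists l : int, `|x - (n%:R * alpha + l%:~R)| < i.+1%:R^-1.
  move=> i; have : 0 < i.+1%:R^-1 :> R by rewrite invr_gt0.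
  move: i.+1%:R^-1 => r r0.
  have [|n [l [ni /andP[l1 l2]]]] := @dense_multiples _ alpha
    (x - r) (x + r) i alpha_irr; first lra.
  by exists n; split => //; exists l; rewrite ltr_norml; apply/andP; split; lra.
exists n; split.
  by move=> U [N _ NU]; exists N => // i /= Ni; apply: NU; exact: leq_trans (n_ge i).
have -> : (fun i => iter (n i) seq_shift (coding (mod1 0))) =
    coding \o (fun i => mod1 (0 + (n i)%:~R * alpha)).
  by apply/funext => i; exact: (ziter_coding alpha beta 0 (n i)).
apply: cvg_comp (coding_continuous Ix) => U /nbhs_mod1/nbhs_ballP[e /= e0 eU].
have := near_infty_natSinv_lt (PosNum e0); apply: filterS => i /= ie.
have [l il] := n_near i; rewrite -(mod1Dz _ l) add0r -pmulrn.
by apply: eU; exact: lt_trans ie.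
Qed.

Lemma Omegatilde_coding x : Itilde (mod1 x) -> Omegatilde (coding (mod1 x)).
Proof.
move=> Ix; split; first exact: Omega_coding.
rewrite -setUA => bad; apply: Ix.
by case: bad => /orbitT_coding[n nx]; [left|right]; apply/orbitS_mod1;
  exists n; exact: coding_or_left_inj nx.
Qed.

Lemma coding_inj (s t : circle R) : coding s = coding t -> s = t.
Proof.
rewrite -(cvalK s) -(cvalK t) => st.
by apply: (coding_or_left_inj hbeta alpha_irr); left.
Qed.

(** The default [mod1 0] occurs only off the image of [Itilde], which is [Omegatilde]. *)
Definition decode w : circle R :=
  xget (mod1 0) [set t | Itilde t /\ coding t = w].

Lemma codingK t : Itilde t -> decode (coding t) = t.
Proof.
by move=> It; apply: xget_unique => // s [_ /coding_inj].
Qed.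

(** Prescribing two symbols is an open condition and already confines the decoded point to an
    [e]-neighbourhood. *)
Lemma decode_continuous : {within Omegatilde, continuous decode}.
Proof.
apply/subspace_continuousP => _ /Omegatilde_surj[x Ix <-].
rewrite /from_subspace codingK// => U /nbhs_mod1/nbhs_ballP[e /= e0 eU].
have [n [m [xn xm loc]]] := two_symbols_locate hbeta x alpha_irr e0.
have /cvg_binseqP near_x := @cvg_id _ (nbhs (coding (mod1 x))).
change (\forall v \near nbhs (coding (mod1 x)), Omegatilde v -> U (decode v)).
apply: filterS2 (near_x n) (near_x m) => v vn vm.
move=> /Omegatilde_surj[y Iy yv].
have [|||k yk] := loc y v; first by left.
- by rewrite vn.
- by rewrite vm.
rewrite -yv codingK// -(mod1Dz _ (- k)); apply: eU.
by rewrite /ball /= mulrNz distrC (_ : _ - x = y - x - k%:~R)//; lra.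
Qed.

End Homeomorphism.

Theorem theorem5 (R : realType) (alpha beta : R) (halpha : 0 < alpha < 1)
    (alpha_irr : irrational alpha) (hbeta : 0 < beta < 1) :
  homeomorphism_on (Itilde alpha beta) (Omegatilde alpha beta)
    (coding alpha beta).
Proof.
split.
- split.
  + by move=> t; rewrite -(cvalK t); exact: Omegatilde_coding.
  + by move=> s t _ _; exact: coding_inj.
  + move=> w /(Omegatilde_surj hbeta)[x Ix <-].
    by exists (mod1 x).
- apply/subspace_continuousP => t; rewrite -(cvalK t) => It.
  apply: cvg_trans (coding_continuous hbeta It).
  by apply: cvg_app; exact: cvg_within.
exists (decode alpha beta); last exact: decode_continuous.
by move=> t /set_mem; exact: codingK.
Qed.
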